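(* Let $(\mathcal M,[\,,\,],\langle\,,\,\rangle)$ be a flat Lorentzian nilpotent Malcev algebra. Then $(\mathcal M,[\,,\,],\langle\,,\,\rangle)$ is a flat Lorentzian nilpotent Lie algebra, i.e. $(\mathcal M,[\,,\,])$ is a (nilpotent) Lie algebra and $K_0=0$.
   Context: All vector spaces are finite dimensional; here the base field is $\mathbb R$. A Malcev algebra is a vector space with an anti-symmetric bilinear bracket satisfying $J(u,v,[u,w])=[J(u,v,w),u]$, where $J(u,v,w)=[[u,v],w]+[[w,u],v]+[[v,w],u]$. It is nilpotent if its lower central series $\mathcal M^1=\mathcal M$, $\mathcal M^{k+1}=[\mathcal M^k,\mathcal M]$ reaches $0$. Lorentzian means endowed with a non-degenerate symmetric bilinear form $\langle\,,\,\rangle$ of signature $(1,n-1)$ (one minus sign). The Levi-Civita product $\bullet$ is defined by $2\langle u\bullet v,w\rangle=\langle[u,v],w\rangle-\langle[v,w],u\rangle+\langle[w,u],v\rangle$; $\mathrm L_u(v)=u\bullet v$. A Malcev algebra with such a form is flat if $K=0$, where $$K(u,v,w)=\mathrm L_{[[u,v],w]}-\mathrm L_{[u,w]}\circ\mathrm L_v-\mathrm L_u\circ\mathrm L_{[v,w]}+\mathrm L_v\circ\mathrm L_u\circ\mathrm L_w-\mathrm L_w\circ\mathrm L_v\circ\mathrm L_u.$$ A Lie algebra with such a form is flat (as a Lie algebra) if $K_0(u,v)=\mathrm L_{[u,v]}-[\mathrm L_u,\mathrm L_v]=0$ for all $u,v$. *)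

(* Defs.v *)
From HB Require Import structures.
From mathcomp Require Import all_boot all_order all_algebra.
From mathcomp Require Import reals ring.

Set Implicit Arguments.
Unset Strict Implicit.
Unset Printing Implicit Defensive.

Import Order.TTheory GRing.Theory Num.Theory.
Local Open Scope ring_scope.

Lemma linear_linfunE (R : nzRingType) (U V : vectType R) (f : U -> V) :
  linear f -> linfun f =1 f.
Proof.
move=> f_lin.
exact: (lfunE (HB.pack_for {linear U -> V} f
  (GRing.isLinear.Build R U V _ f f_lin))).
Qed.

Section Algebras.
Variables (R : realType) (M : vectType R) (br : {bilinear M -> M -> M}).

Definition jacobiator (u v w : M) : M :=
  br (br u v) w + br (br w u) v + br (br v w) u.

Definition antisymmetric_bracket : Prop := forall u v, br u v = - br v u.

Definition malcev_algebra : Prop :=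
  antisymmetric_bracket /\
  forall u v w, jacobiator u v (br u w) = br (jacobiator u v w) u.

Definition lie_algebra : Prop :=
  antisymmetric_bracket /\ forall u v w, jacobiator u v w = 0.

Definition bracketv (U V : {vspace M}) : {vspace M} :=
  <<[seq br u v | u <- vbasis U, v <- vbasis V]>>%VS.

(* The values on the two bases span all the brackets, so that [bracketv U V]
   does not depend on the choice of the bases. *)
Lemma bracketvP (U V W : {vspace M}) :
  reflect (forall u v, u \in U -> v \in V -> br u v \in W)
          (bracketv U V <= W)%VS.
Proof.
apply: (iffP idP) => [/span_subvP sUVW u v uU vV | sUVW]; last first.
  by apply/span_subvP => _ /allpairsP[[u v] /= [Uu Vv ->]];
     apply: sUVW; apply: vbasis_mem.
rewrite (coord_vbasis uU) (coord_vbasis vV) linear_sumlz.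
apply: memv_suml => i _; rewrite linearZl_LR linear_sumr memvZ //.
apply: memv_suml => j _; rewrite linearZr_LR memvZ //.
by apply: sUVW; apply: allpairs_f; apply: mem_nth; rewrite size_tuple.
Qed.

(* With indices starting at 0: [lower_central k] is the (k+1)-st term M^(k+1)
   of the lower central series, where M^1 = M. *)
Fixpoint lower_central (k : nat) : {vspace M} :=
  if k is k'.+1 then bracketv (lower_central k') fullv else fullv.

Definition nilpotent_algebra : Prop := exists k, lower_central k = 0%VS.

End Algebras.

Section Metric.
Variables (R : realType) (M : vectType R).
Implicit Types (g : {symmetric M}) (br : {bilinear M -> M -> M}).

Definition has_signature g (p q : nat) : Prop :=
  exists2 e : (p + q).-tuple M, basis_of fullv e &
    forall i j : 'I_(p + q),
      g e`_i e`_j = if i == j then (if (i < p)%N then -1 else 1) else 0.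

(* The first component of a signature counts the minus signs.  For dim M = 0
   the condition fails, since a basis of M cannot have 1 + 0 elements. *)
Definition lorentzian g : Prop :=
  nondegenerate g /\ has_signature g 1 (\dim {:M}).-1.

Definition musical g : 'Hom(M, 'Hom(M, R^o)) :=
  linfun (fun x => linfun (fun w => g x w : R^o)).

Definition koszul br g (u v : M) : 'Hom(M, R^o) :=
  linfun (fun w => 2^-1 * (g (br u v) w - g (br v w) u + g (br w u) v) : R^o).

(* The Levi-Civita product is the vector that represents the linear form
   [koszul br g u v]; for a nondegenerate [g] it is the only solution of the
   Koszul formula (see [levi_civitaP] and [levi_civita_uniq]). *)
Definition levi_civita br g (u v : M) : M := (musical g)^-1%VF (koszul br g u v).

Definition lc_left br g (u : M) : 'End(M) := linfun (levi_civita br g u).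

Definition malcev_curvature br g (u v w : M) : 'End(M) :=
  let L := lc_left br g in
  (L (br (br u v) w) - (L (br u w) \o L v) - (L u \o L (br v w))
   + (L v \o L u \o L w) - (L w \o L v \o L u))%VF.

Definition malcev_flat br g : Prop := forall u v w, malcev_curvature br g u v w = 0.

Definition lie_curvature br g (u v : M) : 'End(M) :=
  let L := lc_left br g in
  (L (br u v) - ((L u \o L v) - (L v \o L u)))%VF.

Definition lie_flat br g : Prop := forall u v, lie_curvature br g u v = 0.

Lemma musicalE g x w : musical g x w = g x w.
Proof.
have lin1 y : linear (fun w => g y w : R^o).
  by move=> a b c; rewrite linearDr linearZr_LR.
have lin2 : linear (fun y => linfun (fun w => g y w : R^o)).
  move=> a b c; apply/lfunP => z.
  rewrite add_lfunE scale_lfunE !linear_linfunE //.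
  by rewrite linearDl linearZl_LR.
by rewrite /musical !linear_linfunE.
Qed.

Lemma koszulE br g u v w : koszul br g u v w =
  2^-1 * (g (br u v) w - g (br v w) u + g (br w u) v).
Proof.
have lin : linear (fun w =>
    2^-1 * (g (br u v) w - g (br v w) u + g (br w u) v) : R^o).
  move=> a b c; rewrite /GRing.scale /=.
  by rewrite !(linearDr, linearDl, linearZr_LR, linearZl_LR) /=; ring.
by rewrite /koszul linear_linfunE.
Qed.

Lemma musical_ker g : nondegenerate g -> lker (musical g) == 0%VS.
Proof.
move=> /eqP g_nd; rewrite -subv0; apply/subvP => x.
rewrite memv_ker => /eqP x0; rewrite -g_nd; apply/mem_orthovP => w _.
by rewrite -musicalE x0 zero_lfunE.
Qed.

Lemma levi_civitaP br g : nondegenerate g -> forall u v w,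
  2 * g (levi_civita br g u v) w = g (br u v) w - g (br v w) u + g (br w u) v.
Proof.
move=> g_nd u v w.
have k0 := musical_ker g_nd.
have full : limg (musical g) = fullv.
  apply/eqP; rewrite eqEdim subvf limg_dim_eq; last by rewrite (eqP k0) capv0.
  by rewrite !dimvf /dim /= muln1.
rewrite -musicalE limg_lfunVK ?full ?memvf // koszulE.
by rewrite mulrA mulfV ?mul1r // pnatr_eq0.
Qed.

Lemma levi_civita_uniq br g : nondegenerate g -> forall p : M -> M -> M,
  (forall u v w,
     2 * g (p u v) w = g (br u v) w - g (br v w) u + g (br w u) v) ->
  forall u v, p u v = levi_civita br g u v.
Proof.
move=> g_nd p pP u v; apply/(lker0P (musical_ker g_nd)).
apply/lfunP => w; rewrite !musicalE.
have two0 : (2 : R) != 0 by rewrite pnatr_eq0.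
by apply: (mulfI two0); rewrite pP levi_civitaP.
Qed.

Lemma lc_leftE br g u v : lc_left br g u v = levi_civita br g u v.
Proof.
have lin : linear (levi_civita br g u).
  move=> a b c; rewrite /levi_civita -linearP; congr (_ _).
  apply/lfunP => w; rewrite add_lfunE scale_lfunE !koszulE.
  rewrite /GRing.scale /=.
  by rewrite !(linearDr, linearDl, linearZr_LR, linearZl_LR) /=; ring.
by rewrite /lc_left linear_linfunE.
Qed.

End Metric.

(* Main.v *)
Require Import Defs.
From mathcomp Require Import all_boot all_order all_algebra.
From mathcomp Require Import reals.
From HB Require Import structures.
From mathcomp Require Import ring lra.
From mathcomp Require boolp.

Import Order.TTheory GRing.Theory Num.Theory.
Local Open Scope ring_scope.

(** Write u • v for the Levi-Civita product, L_u for v |-> u • v, and K0 for the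
    Lie curvature.  Since • is torsion free, the cyclic sum of K0(u,v)w is the
    Jacobiator of u, v, w; hence it is enough to prove K0 = 0, and the Jacobi
    identity follows ([lie_flat_lie]).  If the bracket vanishes, so does •.

    If the bracket does not vanish, pick z <> 0 central in [M, M].  Flatness
    makes L_z commute with every product L_v L_u, and evaluation at z, where
    L_u z = L_z u and L_z z = 0, gives L_z L_v L_z = 0
    ([central_lc_sandwich]).  Each L_u is skew and, in Lorentzian signature, two
    orthogonal null vectors are proportional; this forces either L_z = 0 or
    L_z^2 <> 0.  Accordingly e = z, or some e = L_z^2 x, is a null vector with
    v • e = 0 for all v, and e • v = 0 by nilpotency
    ([exists_parallel_null]).

    All products lie in I = e^perp, on which the form is positive semidefinite
    with radical the line Re.  The same sandwich identity relative to
    (I, Re) shows that [I, I], and then I • I, lies in Re: this is the statement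
    that a flat Euclidean nilpotent algebra has zero product, applied to I / Re
    without forming the quotient.

    It remains to compute K0 on M, which is I plus one more direction.  Adding
    the flatness identity to its adjoint shows that K0(u,w) anticommutes with
    L_u ([lc_curv_anticommute] is the polarization of this fact).  For b in I
    this makes every K0(d,b)x a null vector of I, hence a multiple of e; and a
    skew operator with values in Re is zero, because e^perp is not all of M
    ([lc_curv_mixed]). *)

(** * The Levi-Civita product and Lorentzian forms *)

Section LeviCivita.
Context {R : realType} {M : vectType R}.
Variables (br : {bilinear M -> M -> M}) (g : {symmetric M}).

Local Notation "u • v" := (levi_civita br g u v)
  (at level 40, left associativity).

Fact levi_civita_bilinear : bilinear_for *:%R *:%R (levi_civita br g).
Proof.
split=> [v a u1 u2 | u a v1 v2]; last by rewrite -!lc_leftE linearP.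
rewrite /levi_civita -linearP; congr (_ _).
apply/lfunP => w; rewrite add_lfunE scale_lfunE !koszulE /GRing.scale /=.
by rewrite !(linearDr, linearDl, linearZr_LR, linearZl_LR) /=; ring.
Qed.

HB.instance Definition _ :=
  bilinear_isBilinear.Build R M M M *:%R *:%R (levi_civita br g)
    levi_civita_bilinear.

Definition bilE := (@linearDl, @linearDr, @linearBl, @linearBr, @linearNl,
  @linearNr).

Lemma memv_bracket (U V : {vspace M}) u v :
  u \in U -> v \in V -> br u v \in bracketv br U V.
Proof. exact: (elimT (bracketvP br U V _) (subvv _)). Qed.

Lemma form_sym x y : g x y = g y x.
Proof. by rewrite hermC /= expr0 mul1r. Qed.

Lemma nondegenerate_eq0 x : nondegenerate g -> (forall y, g x y = 0) -> x = 0.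
Proof.
move=> /eqP g_nd gx0; apply/eqP; rewrite -memv0 -g_nd.
by apply/mem_orthovP => y _; rewrite gx0.
Qed.

(** The hyperplane is spanned by the positive vectors of an orthonormal basis;
    it is given by the coordinate on the negative one, so that a vector can be
    moved into it by subtracting a multiple of any vector off it. *)
Lemma lorentzian_positive_hyperplane : lorentzian g ->
  exists c : {linear M -> R^o}, forall x, c x = 0 ->
    0 <= g x x /\ (g x x = 0 -> x = 0).
Proof.
case=> _; set n := _.-1 => -[b b_basis gb].
exists (coord b ord0) => x x0.
have b_mem : x \in <<b>>%VS by rewrite (span_basis b_basis) memvf.
have gxx : g x x = \sum_(i < 1 + n) coord b i x ^+ 2.
  rewrite {1 2}(coord_span b_mem) linear_sumlz; apply: eq_bigr => i _.
  rewrite linear_sumr (bigD1 i) //= big1 ?addr0 => [|j ji]; last first.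
    by rewrite linearZl_LR linearZr_LR /= gb eq_sym (negPf ji) !mulr0.
  rewrite linearZl_LR linearZr_LR /= gb eqxx.
  case: ltnP => [|_]; last by rewrite mulr1.
  rewrite ltnS leqn0 => /eqP i0.
  have -> : i = ord0 by apply: val_inj.
  by rewrite x0; ring.
split=> [|xx0]; first by rewrite gxx; apply: sumr_ge0 => i _; apply: sqr_ge0.
rewrite (coord_span b_mem) big1 // => i _.
suff /eqP : coord b i x ^+ 2 = 0 by rewrite sqrf_eq0 => /eqP ->; rewrite scale0r.
by apply: (psumr_eq0P _ (etrans (esym gxx) xx0)) => // j _; apply: sqr_ge0.
Qed.

(** Subtracting from x the multiple of e that brings it into the positive
    hyperplane does not change g x x, because e is null and orthogonal to x. *)
Lemma lorentzian_orthogonal_null (e x : M) : lorentzian g ->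
  e != 0 -> g e e = 0 -> g e x = 0 -> 0 <= g x x /\ (g x x = 0 -> x \in <[e]>%VS).
Proof.
move=> /lorentzian_positive_hyperplane[c c_pos] e0 ee0 ex0.
have ce0 : c e != 0.
  by apply: contra_neq e0 => /c_pos[_]; apply.
pose y := x - (c x / c e) *: e.
have /c_pos : c y = 0.
  by rewrite linearB linearZ /= /GRing.scale /= divfK // subrr.
have -> : g y y = g x x.
  rewrite /y !bilE !(linearZl_LR, linearZr_LR) /= (form_sym x e) ex0 ee0; ring.
case=> ge0 y0; split=> // /y0 /eqP; rewrite subr_eq0 => /eqP ->.
by rewrite memvZ ?memv_line.
Qed.

(** * Skewness, torsion and curvature *)

Hypotheses (br_anti : antisymmetric_bracket br) (g_nd : nondegenerate g).

Lemma lc_skew u v w : g (u • v) w = - g v (u • w).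
Proof.
have := levi_civitaP br g_nd u v w; have := levi_civitaP br g_nd u w v.
rewrite (br_anti w v) (br_anti v u) (br_anti w u) !bilE /= (form_sym v).
lra.
Qed.

Lemma lc_skew_self u v : g (u • v) v = 0.
Proof. by have := lc_skew u v v; rewrite (form_sym v); lra. Qed.

Lemma lc_torsion_free u v : br u v = u • v - v • u.
Proof.
apply/eqP; rewrite -subr_eq0; apply/eqP; apply: nondegenerate_eq0 => // w.
have := levi_civitaP br g_nd u v w; have := levi_civitaP br g_nd v u w.
rewrite (br_anti w v) (br_anti v u) (br_anti w u) !bilE /=.
lra.
Qed.

Definition lc_curv u v x : M := br u v • x - u • (v • x) + v • (u • x).

Lemma lie_curvatureE u v x : lie_curvature br g u v x = lc_curv u v x.
Proof.
by rewrite /lie_curvature !lfun_simp /= !lc_leftE opprB addrA addrAC.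
Qed.

Lemma lc_curv_skew u v x y : g (lc_curv u v x) y = - g x (lc_curv u v y).
Proof.
rewrite /lc_curv !bilE /= (lc_skew (br u v)) (lc_skew u (v • x)).
rewrite (lc_skew v (u • x)) (lc_skew v x) (lc_skew u x); lra.
Qed.

Lemma lc_curv_anti u v x : lc_curv u v x = - lc_curv v u x.
Proof. by rewrite /lc_curv br_anti !bilE /= !opprD !opprK addrAC. Qed.

(** First Bianchi identity: for a torsion-free product, the cyclic sum of the
    curvature is the Jacobiator. *)
Lemma lie_flat_lie : lie_flat br g -> lie_algebra br.
Proof.
move=> flat; split=> // u v w.
have K0 a b x y : g (lc_curv a b x) y = 0.
  by rewrite -lie_curvatureE flat zero_lfunE linear0l.
apply: nondegenerate_eq0 => // y; move: (K0 u v w y) (K0 w u v y) (K0 v w u y).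
have lc_br a b c : a • br b c = a • (b • c) - a • (c • b).
  by rewrite lc_torsion_free linearBr.
rewrite /jacobiator /lc_curv !(lc_torsion_free (br _ _)) !lc_br !bilE /=; lra.
Qed.

Hypothesis flat : malcev_flat br g.

Lemma lc_flatE u v w x : br (br u v) w • x =
  br u w • (v • x) + u • (br v w • x) - v • (u • (w • x)) + w • (v • (u • x)).
Proof.
have /lfunP/(_ x) := flat u v w; rewrite /malcev_curvature !lfun_simp /=.
rewrite !lc_leftE => /eqP; rewrite subr_eq0 => /eqP <-.
by rewrite -[_ - _ - _]addrA -opprD addrACA addNr addr0 addrC subrK.
Qed.

(** The operators L_a being skew, the adjoint of the flatness identity reverses
    each word in them; the sum of the identity and its adjoint is free of
    L_[[u,v],w] and rearranges into anticommutators of K0 with L.  For u = v it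
    says that K0(u,w) anticommutes with L_u. *)
Lemma lc_curv_anticommute u v w x :
  lc_curv u w (v • x) + v • lc_curv u w x +
  (lc_curv v w (u • x) + u • lc_curv v w x) = 0.
Proof.
apply: nondegenerate_eq0 => // y.
have := congr1 (g ^~ y) (lc_flatE u v w x).
have := congr1 (g x) (lc_flatE u v w y).
rewrite /lc_curv !bilE /= !lc_skew.
lra.
Qed.
(** * Relatively central elements of a flat algebra *)

(** In this part, V stands for a subalgebra and N for a subspace that acts
    trivially; z is central in V modulo N.  The pair (M, 0) gives the honest
    centre, and the pair (e^perp, Re) replaces the quotient e^perp / Re.
    In the flatness identity at (u, v, z) the three terms that contain a bracket
    with z disappear. *)
Lemma central_lc_commute z (V N : {vspace M}) :
  (forall u v, u \in V -> v \in V -> br u v \in V) ->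
  (forall n x, n \in N -> n • x = 0) ->
  (forall v, v \in V -> br z v \in N) ->
  forall u v x, u \in V -> v \in V -> z • (v • (u • x)) = v • (u • (z • x)).
Proof.
move=> Vbr N0 zN u v x uV vV; have := lc_flatE u v z x.
have brz0 w y : w \in V -> br w z • y = 0.
  by move=> wV; rewrite br_anti linearNl /= N0 ?oppr0 // zN.
rewrite !brz0 ?Vbr // linear0r addr0 add0r.
by move/eqP; rewrite eq_sym addrC subr_eq0 => /eqP.
Qed.

(** Evaluate the commutation of L_z with L_v L_u at z itself: z • z is in N, as
    it is orthogonal to V, and u • z agrees with z • u modulo N. *)
Lemma central_lc_sandwich z (V N : {vspace M}) :
  (forall u v, u \in V -> v \in V -> u • v \in V) ->
  (forall n x, n \in N -> n • x = 0) ->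
  (forall x n, n \in N -> x • n = 0) ->
  (forall x, x \in V -> (forall v, v \in V -> g x v = 0) -> x \in N) ->
  (forall n v, n \in N -> v \in V -> g n v = 0) ->
  z \in V -> (forall v, v \in V -> br z v \in N) ->
  forall u v, u \in V -> v \in V -> z • (v • (z • u)) = 0.
Proof.
move=> Vlc N0 lcN0 Nrad Nort zV zN u v uV vV.
have Vbr a b : a \in V -> b \in V -> br a b \in V.
  by move=> aV bV; rewrite lc_torsion_free memvB // Vlc.
have zzN : z • z \in N.
  apply: Nrad => [|w wV]; first exact: Vlc.
  have := levi_civitaP br g_nd z z w; rewrite (br_anti w z) linearNl /=.
  rewrite (Nort (br z z)) ?(Nort (br z w)) ?zN //; lra.
have -> : z • u = u • z + br z u by rewrite lc_torsion_free addrCA subrr addr0.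
rewrite linearDr /= (lcN0 v (br z u)) ?zN // addr0.
by rewrite (central_lc_commute z V N) // (lcN0 u (z • z)) // linear0r.
Qed.

(** The last of the subspaces M^k :&: [V, V] that is not contained in N provides
    z: its bracket with V falls into the next one. *)
Lemma nilpotent_relative_center (V N : {vspace M}) : nilpotent_algebra br ->
  (forall u v, u \in V -> v \in V -> br u v \in V) ->
  ~~ (bracketv br V V <= N)%VS ->
  exists z, [/\ z \in bracketv br V V, z \notin N &
    forall v, v \in V -> br z v \in N].
Proof.
move=> [k Mk0] Vbr VVN.
pose S k := (lower_central br k :&: bracketv br V V)%VS.
have exS : exists k, (S k <= N)%VS by exists k; rewrite /S Mk0 cap0v sub0v.
case: (ex_minnP exS) => -[|j] Sj min_j.
  by move: Sj VVN; rewrite /S /= capfv => ->.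
have /subvPn[z] : ~~ (S j <= N)%VS.
  by apply/negP => /min_j; rewrite ltnn.
rewrite memv_cap => /andP[zj zVV] zN; exists z; split=> // v vV.
have zV : z \in V.
  by have /subvP := introT (bracketvP br V V V) Vbr; apply.
apply: (subvP Sj); rewrite memv_cap; apply/andP; split.
  exact: memv_bracket zj (memvf _).
exact: memv_bracket.
Qed.

(** * A parallel null vector *)

(** As v • e = 0, the operator L_e equals ad e and is nilpotent, and its image is
    orthogonal to e.  If L_e <> 0, the last nonzero power of L_e has a null image
    orthogonal to e, so e is a multiple of some [e, y]; then e lies in all the
    terms of the lower central series. *)
Lemma parallel_null_central (e : M) : nilpotent_algebra br -> lorentzian g ->
  e != 0 -> g e e = 0 -> (forall v, v • e = 0) -> forall v, e • v = 0.
Proof.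
move=> [k Mk0] g_lor e0 gee eP.
have br_e v : br e v = e • v by rewrite lc_torsion_free eP subr0.
have e_im y : e <> e • y.
  move=> e_y; have : e \in lower_central br k.
    elim: {Mk0} k => [|k IHk]; first exact: memvf.
    rewrite {1}e_y -br_e.
    exact: memv_bracket IHk (memvf _).
  by rewrite Mk0 memv0 (negPf e0).
pose A n x := iter n (levi_civita br g e) x.
have A_lower n x : A n x \in lower_central br n.
  elim: n => [|n IHn]; first exact: memvf.
  rewrite /A iterS -br_e br_anti memvN.
  exact: memv_bracket IHn (memvf _).
have A0 n : (forall x, A n.+1 x = 0) -> forall x, A 1 x = 0.
  elim: n => // n IHn An; apply: IHn => x.
  (* The induction step passes from A^(n+2) = 0 to A^(n+1) = 0: by skewness
     g (A^(n+1) x) (A^(n+1) x) = - g (A^n x) (A^(n+2) x). *)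
  have orth : g e (A n.+1 x) = 0.
    by rewrite /A /= -[LHS]opprK -lc_skew eP linear0l oppr0.
  have null : g (A n.+1 x) (A n.+1 x) = 0.
    by rewrite {1}/A /= lc_skew [e • _]An linear0r oppr0.
  have [_ /(_ null) /vlineP[c Ac]] :=
    lorentzian_orthogonal_null e (A n.+1 x) g_lor e0 gee orth.
  have [c0|c0] := eqVneq c 0; first by rewrite Ac c0 scale0r.
  case: (e_im (c^-1 *: A n x)).
  have -> : e • (c^-1 *: A n x) = c^-1 *: A n.+1 x by rewrite linearZr_LR.
  by rewrite Ac scalerA mulVf // scale1r.
apply: (A0 k) => x.
have := A_lower k x; rewrite Mk0 memv0 => /eqP Ak.
by rewrite /A /= [iter _ _ _]Ak linear0r.
Qed.

(** If L_z^2 <> 0, the sandwich identity gives L_v L_z^2 = 0, so the image of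
    L_z^2 is parallel and null.  If L_z^2 = 0, the image of the skew operator L_z
    is totally null, so of dimension at most one; the rank of a skew operator
    being even, L_z = 0.  Then z is orthogonal to [M, M], which contains z. *)
Lemma exists_parallel_null : nilpotent_algebra br -> lorentzian g ->
  (exists u v, br u v != 0) ->
  exists e, [/\ e != 0, g e e = 0, forall v, v • e = 0 & forall v, e • v = 0].
Proof.
move=> nil g_lor [u0 [v0 uv0]].
have [z [zMM z0 zC]] : exists z, [/\ z \in bracketv br fullv fullv,
    z \notin 0%VS & forall v, v \in fullv -> br z v \in 0%VS].
  apply: nilpotent_relative_center => //[u v _ _|]; first exact: memvf.
  apply: contra uv0 => /bracketvP/(_ u0 v0 (memvf _) (memvf _)).
  by rewrite memv0.
have {}zC v : br z v = 0 by apply/eqP; rewrite -memv0 zC ?memvf.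
rewrite memv0 in z0.
have comm u v x : z • (v • (u • x)) = v • (u • (z • x)).
  apply: (central_lc_commute z fullv 0) => //; rewrite ?memvf //.
  - by move=> *; apply: memvf.
  - by move=> n y; rewrite memv0 => /eqP ->; rewrite linear0l.
  - by move=> v' _; rewrite zC mem0v.
have sandwich u v : z • (v • (z • u)) = 0.
  apply: (central_lc_sandwich z fullv 0) => //; rewrite ?memvf //.
  - by move=> *; apply: memvf.
  - by move=> n x; rewrite memv0 => /eqP ->; rewrite linear0l.
  - by move=> n x; rewrite memv0 => /eqP ->; rewrite linear0r.
  - move=> x _ x0; rewrite memv0; apply/eqP/nondegenerate_eq0 => // y.
    by rewrite x0 ?memvf.
  - by move=> n x; rewrite memv0 => /eqP ->; rewrite linear0l.
  - by move=> v' _; rewrite zC mem0v.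
have [[x e0]|no_e] := boolp.pselect (exists x, z • (z • x) != 0).
  have eP v : v • (z • (z • x)) = 0 by rewrite -comm sandwich.
  have gee : g (z • (z • x)) (z • (z • x)) = 0.
    by rewrite lc_skew eP linear0r oppr0.
  exists (z • (z • x)); split=> // v.
  exact: parallel_null_central.
have zz0 x : z • (z • x) = 0.
  by apply/eqP/negPn/negP => zzx; apply: no_e; exists x.
have zP x : z • x = 0.
  have [//|f0] := eqVneq (z • x) 0.
  (* All the z • y are multiples of z • x, which is orthogonal to x; moving
     L_z to the other side, z • x is orthogonal to every y. *)
  have null y y' : g (z • y) (z • y') = 0.
    by rewrite lc_skew zz0 linear0r oppr0.
  apply: nondegenerate_eq0 => // y; rewrite lc_skew.
  have [_ /(_ (null y y)) /vlineP[c ->]] :=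
    lorentzian_orthogonal_null _ (z • y) g_lor f0 (null x x) (null x y).
  by rewrite linearZr_LR /= form_sym lc_skew_self mulr0 oppr0.
have Pz v : v • z = 0.
  by apply/eqP; rewrite -oppr_eq0 -(zC v) lc_torsion_free zP sub0r.
exists z; split=> //.
have : (bracketv br fullv fullv <= orthov g <[z]>)%VS.
  apply/bracketvP => u v _ _; rewrite mem_orthov1; apply/eqP.
  have := levi_civitaP br g_nd z u v; rewrite zP zC (br_anti v z) zC.
  rewrite oppr0 !linear0l; lra.
by move=> /subvP/(_ z zMM); rewrite mem_orthov1 => /eqP.
Qed.

(** * The curvature in the presence of a parallel null vector *)

Section ParallelNull.
Hypotheses (nil : nilpotent_algebra br) (g_lor : lorentzian g).
Variable e : M.
Hypotheses (e_neq0 : e != 0) (gee : g e e = 0).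
Hypotheses (lc_e : forall v, v • e = 0) (e_lc : forall v, e • v = 0).

Let I : {vspace M} := orthov g <[e]>.

Let memI x : (x \in I) = (g x e == 0).
Proof. by rewrite mem_orthov1. Qed.

Let lcI u v : u • v \in I.
Proof. by rewrite memI lc_skew lc_e linear0r oppr0. Qed.

Let lcN n x : n \in <[e]>%VS -> n • x = 0.
Proof. by move=> /vlineP[c ->]; rewrite linearZl_LR /= e_lc scaler0. Qed.

Let lcrN x n : n \in <[e]>%VS -> x • n = 0.
Proof. by move=> /vlineP[c ->]; rewrite linearZr_LR /= lc_e scaler0. Qed.

Let orthIN x n : x \in I -> n \in <[e]>%VS -> g x n = 0.
Proof.
by rewrite memI => /eqP xe /vlineP[c ->]; rewrite linearZr_LR /= xe mulr0.
Qed.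

Let null_line x : x \in I -> g x x = 0 -> x \in <[e]>%VS.
Proof.
rewrite memI form_sym => /eqP ex.
by have [_] := lorentzian_orthogonal_null e x g_lor e_neq0 gee ex.
Qed.

(** Otherwise some z in [I, I] outside Re is central in I modulo Re.  The form
    being semidefinite on I, the skew operator L_z with L_z^3 = 0 on I maps I
    into Re.  By the Koszul formula z is then orthogonal to [I, I], hence to
    itself, and lies in Re. *)
Lemma parallel_null_perp_bracket u v :
  u \in I -> v \in I -> br u v \in <[e]>%VS.
Proof.
have brI a b : br a b \in I by rewrite lc_torsion_free memvB.
have [/bracketvP IIN|IIN] := boolP (bracketv br I I <= <[e]>)%VS.
  exact: IIN.
have [|z [zII zN0 zN]] := nilpotent_relative_center _ _ nil _ IIN.
  by move=> *; apply: brI.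
case/negP: zN0.
have zI : z \in I.
  by apply: (elimT subvP _ _ zII); apply/bracketvP => *; apply: brI.
have sandwich a : a \in I -> z • (z • (z • a)) = 0.
  move=> aI; apply: (central_lc_sandwich z I <[e]>) => // [x xI xort|n x nN xI].
    exact: null_line (xort x xI).
  by rewrite form_sym orthIN.
have zlc a : a \in I -> z • a \in <[e]>%VS.
  move=> aI; apply: null_line; rewrite ?lcI // lc_skew orthIN ?oppr0 //.
  by apply: null_line; rewrite ?lcI // lc_skew sandwich // linear0r oppr0.
apply: null_line => //.
suff /subvP/(_ z zII) : (bracketv br I I <= orthov g <[z]>)%VS.
  by rewrite mem_orthov1 => /eqP.
apply/bracketvP => a b aI bI; rewrite mem_orthov1; apply/eqP.
have := levi_civitaP br g_nd z a b; rewrite (br_anti b z) linearNl /=.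
rewrite (form_sym (z • a)) (form_sym (br z a)) (form_sym (br z b)).
rewrite (orthIN b (z • a)) ?(orthIN b (br z a)) ?(orthIN a (br z b)) ?zN ?zlc //.
lra.
Qed.

Lemma parallel_null_perp_lc u v : u \in I -> v \in I -> u • v \in <[e]>%VS.
Proof.
move=> uI vI; apply: null_line; first exact: lcI.
have gbr a b c : a \in I -> b \in I -> c \in I -> g (br a b) c = 0.
  by move=> aI bI cI; rewrite form_sym orthIN // parallel_null_perp_bracket.
have := levi_civitaP br g_nd u v (u • v); rewrite !gbr //; lra.
Qed.

Let g_d_neq0 : exists d, g d e != 0.
Proof.
have [//|no] := boolp.pselect (exists d, g d e != 0).
case/eqP: e_neq0; apply: nondegenerate_eq0 => // y; rewrite form_sym.
by apply/eqP/negPn/negP => yP; apply: no; exists y.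
Qed.

Let perp_complement d x : g d e != 0 -> exists a y, y \in I /\ x = a *: d + y.
Proof.
move=> de; exists (g x e / g d e), (x - (g x e / g d e) *: d).
split; last by rewrite addrCA subrr addr0.
by rewrite memI linearBl /= linearZl_LR /= divfK // subrr.
Qed.

Let lc_curvI u v x : lc_curv u v x \in I.
Proof. by rewrite /lc_curv memvD ?memvB. Qed.

(** A skew operator of rank at most one vanishes; d serves to detect multiples
    of e. *)
Let lc_curv_eq0 u v :
  (forall x, lc_curv u v x \in <[e]>%VS) -> forall x, lc_curv u v x = 0.
Proof.
move=> KN; have [d de] := g_d_neq0.
have line0 x : g (lc_curv u v x) d = 0 -> lc_curv u v x = 0.
  have /vlineP[c ->] := KN x.
  rewrite linearZl_LR /= form_sym => /eqP; rewrite mulf_eq0 (negPf de) orbF.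
  by move=> /eqP ->; rewrite scale0r.
have Kd : lc_curv u v d = 0.
  by apply: line0; have := lc_curv_skew u v d d; rewrite (form_sym d); lra.
by move=> x; apply: line0; rewrite lc_curv_skew Kd linear0r oppr0.
Qed.

Lemma lc_curv_perp u v x : u \in I -> v \in I -> lc_curv u v x = 0.
Proof.
move=> uI vI; apply: lc_curv_eq0 => {}x.
rewrite /lc_curv lcN ?parallel_null_perp_bracket //.
by rewrite memvD ?memvB ?mem0v // parallel_null_perp_lc.
Qed.

(** Put w = K0(d,v)x and c = [d, v].  To see that w is null, expand
    g w w = g (c • x) w - g (d • (v • x)) w + g (v • (d • x)) w.
    In the last two terms a vector of Re meets a vector of I: v • (d • x) is in
    Re, and so is d • w because K0(d,v) anticommutes with L_d.  The operators
    K0(d,v) and L_c, both skew, anticommute too, because K0(c,v) = 0; so their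
    product is skew, and g (c • x) w = - g x (c • w) is zero. *)
Lemma lc_curv_mixed d v x : v \in I -> lc_curv d v x = 0.
Proof.
move=> vI; apply: lc_curv_eq0 => {}x.
have brI : br d v \in I by rewrite lc_torsion_free memvB.
have KIN y : y \in I -> lc_curv d v y \in <[e]>%VS.
  move=> yI; rewrite /lc_curv (lcrN d (v • y)) ?subr0; last exact: parallel_null_perp_lc.
  by rewrite memvD ?parallel_null_perp_lc.
set w := lc_curv d v x; have wI : w \in I := lc_curvI d v x.
have dw : d • w = - lc_curv d v (d • x).
  have := lc_curv_anticommute d d v x; rewrite -mulr2n => /eqP.
  rewrite -scaler_nat scaler_eq0 pnatr_eq0 /= addrC addr_eq0.
  by move=> /eqP.
have cw : br d v • w = - lc_curv d v (br d v • x).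
  have := lc_curv_anticommute d (br d v) v x.
  rewrite !(lc_curv_perp (br d v)) // linear0r !addr0 => /eqP.
  by rewrite addrC addr_eq0 => /eqP.
apply: null_line => //; rewrite -/w.
have c0 : g (br d v • x) w = 0.
  have : g (br d v • x) w = - g (br d v • x) w.
    by rewrite {1}lc_skew cw linearNr /= opprK form_sym lc_curv_skew.
  lra.
have d0 : g (d • (v • x)) w = 0.
  by rewrite lc_skew orthIN ?oppr0 // dw memvN KIN.
have v0 : g (v • (d • x)) w = 0.
  by rewrite form_sym orthIN // parallel_null_perp_lc.
by rewrite {1}/w /lc_curv linearDl /= linearBl /= c0 d0 v0 subrr addr0.
Qed.

(** K0(u,v) is bilinear and alternating, and M is the sum of I and a line. *)
Lemma lc_curv_parallel_null u v x : lc_curv u v x = 0.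
Proof.
have [d de] := g_d_neq0.
have curv_line a b : exists c, lc_curv a b x = c *: lc_curv a d x.
  have [c [y [yI ->]]] := perp_complement d b de; exists c.
  rewrite -[RHS]addr0 -(lc_curv_mixed a y x yI) /lc_curv.
  rewrite !(linearDr, linearDl, linearZr_LR, linearZl_LR) /=.
  rewrite opprD !scalerDr scalerN (addrACA (c *: (br a d • x))).
  by rewrite (addrACA (c *: (br a d • x) - _)).
have dd : lc_curv d d x = 0.
  by rewrite /lc_curv addrNK lc_torsion_free subrr linear0l.
have [b ->] := curv_line u v; have [c] := curv_line d u.
by rewrite (lc_curv_anti u) => ->; rewrite dd scaler0 oppr0 scaler0.
Qed.

End ParallelNull.
End LeviCivita.

Theorem proposition4p6 (R : realType) (M : vectType R)
    (br : {bilinear M -> M -> M}) (g : {symmetric M}) :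
  malcev_algebra br -> nilpotent_algebra br -> lorentzian g ->
  malcev_flat br g ->
  [/\ lie_algebra br, nilpotent_algebra br, lorentzian g & lie_flat br g].
Proof.
move=> [br_anti _] nil g_lor flat; have [g_nd _] := g_lor.
have K0 u v x : lc_curv br g u v x = 0.
  have [[a [b ab]]|ab0] := boolp.pselect (exists a b, br a b != 0).
    have [e [e0 gee lc_e e_lc]] := exists_parallel_null br g br_anti g_nd flat
      nil g_lor (ex_intro _ a (ex_intro _ b ab)).
    exact: (lc_curv_parallel_null br g br_anti g_nd flat nil g_lor e).
  have br0 a b : br a b = 0.
    by apply/eqP/negPn/negP => ab; apply: ab0; exists a, b.
  have lc0 a b : levi_civita br g a b = 0.
    apply: (nondegenerate_eq0 g) => // y; have := levi_civitaP br g_nd a b y.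
    rewrite !br0 !linear0l; lra.
  by rewrite /lc_curv !lc0 subrr addr0.
have lflat : lie_flat br g.
  by move=> u v; apply/lfunP => x; rewrite lie_curvatureE K0 zero_lfunE.
by split=> //; apply: (lie_flat_lie br g).
Qed.
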